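(* Let $k$ be an infinite field, let $S=\langle g_1,\dots,g_n\rangle$ be a numerical semigroup with smallest minimal generator $g_1$, and let $R=k[[t^S]]$. If $|\{\omega_i\in \mathrm{Ap}(S) : a_i>b_i\}|\le 3$, then the Hilbert function $H_R$ is non-decreasing.
   Context: A numerical semigroup $S$ is a subsemigroup of $(\mathbb{N},+)$ containing $0$; $S=\langle g_1,\dots,g_n\rangle$ means that $g_1<g_2<\dots<g_n$ is its minimal set of generators, and it is assumed that $\gcd(g_1,\dots,g_n)=1$ (equivalently $\mathbb{N}\setminus S$ is finite). Put $M=S\setminus\{0\}$, $0M=S$, and for $h\ge 1$ let $hM=\{m_1+\dots+m_h : m_1,\dots,m_h\in M\}$. The Apéry set of $S$ with respect to $g_1$ is $\mathrm{Ap}(S)=\{\omega_0,\dots,\omega_{g_1-1}\}$, where $\omega_i=\min\{s\in S : s\equiv i \pmod{g_1}\}$. The blow up of $S$ is the numerical semigroup $S'=\bigcup_{i}(iM-_{\mathbb{Z}} iM)$, where $iM-_{\mathbb{Z}}iM=\{z\in\mathbb{Z} : z+l\in iM \text{ for all } l\in iM\}$; it is generated (not necessarily minimally) by $g_1, g_2-g_1,\dots,g_n-g_1$. Its Apéry set with respect to $g_1$ is $\{\omega'_0,\dots,\omega'_{g_1-1}\}$, with $\omega'_i=\min\{s\in S' : s\equiv i \pmod{g_1}\}$. For $i=0,\dots,g_1-1$, $a_i$ is the unique integer with $\omega'_i+a_ig_1=\omega_i$, and $b_i=\max\{l : \omega_i\in lM\}$. The semigroup ring is $R=k[[t^S]]=k[[t^{g_1},\dots,t^{g_n}]]$,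 a one-dimensional local domain with maximal ideal $\mathfrak{m}=(t^{g_1},\dots,t^{g_n})$. Its Hilbert function is $H_R(h)=\dim_k \mathfrak{m}^h/\mathfrak{m}^{h+1}$ for $h\ge 0$ (with $\mathfrak{m}^0=R$), and one has $H_R(h)=|hM\setminus (h+1)M|$ for all $h\ge 0$. Non-decreasing means $H_R(h-1)\le H_R(h)$ for all $h\ge 1$. *)

(* Defs.v *)
From HB Require Import structures.
From mathcomp Require Import all_boot all_order all_algebra.
From mathcomp Require Import mathcomp_extra boolp classical_sets functions cardinality.

Set Implicit Arguments.
Unset Strict Implicit.
Unset Printing Implicit Defensive.

Import Order.TTheory GRing.Theory Num.Theory.
Local Open Scope classical_set_scope.
Local Open Scope ring_scope.

(** * Formal power series *)

(* A record rather than an alias of [nat -> K], which already carries the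
   pointwise ring structure. *)
Record fps (K : Type) := Fps { fps_coef :> nat -> K }.

HB.instance Definition _ (K : Type) := [isNew for @fps_coef K].
HB.instance Definition _ (K : choiceType) := [Choice of fps K by <:].

Lemma fpsP (K : Type) (f g : fps K) : fps_coef f =1 fps_coef g -> f = g.
Proof. by case: f g => [f] [g] /= /funext ->. Qed.

Section FpsRing.
Variable K : comNzRingType.
Implicit Types f g h : fps K.

Definition fps_zero : fps K := Fps (fun=> 0).
Definition fps_opp f : fps K := Fps (fun n => - f n).
Definition fps_add f g : fps K := Fps (fun n => f n + g n).
Definition fps_one : fps K := Fps (fun n => (n == 0%N)%:R).
Definition fps_mul f g : fps K :=
  Fps (fun n => \sum_(i < n.+1) f i * g (n - i)%N).
Definition fps_scale (a : K) f : fps K := Fps (fun n => a * f n).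

Fact fps_addA : associative fps_add.
Proof. by move=> f g h; apply: fpsP => n /=; rewrite addrA. Qed.
Fact fps_addC : commutative fps_add.
Proof. by move=> f g; apply: fpsP => n /=; rewrite addrC. Qed.
Fact fps_add0 : left_id fps_zero fps_add.
Proof. by move=> f; apply: fpsP => n /=; rewrite add0r. Qed.
Fact fps_addN : left_inverse fps_zero fps_opp fps_add.
Proof. by move=> f; apply: fpsP => n /=; rewrite addNr. Qed.

HB.instance Definition _ :=
  GRing.isZmodule.Build (fps K) fps_addA fps_addC fps_add0 fps_addN.

Let trunc n f : {poly K} := \poly_(i < n.+1) f i.

Let mul_trunc n m f g : (m <= n)%N ->
  fps_mul f g m = (trunc n f * trunc n g)`_m.
Proof.
move=> le_mn; rewrite coefM /=; apply: eq_bigr => i _.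
rewrite !coef_poly !ifT // ltnS; first exact: leq_trans (leq_subr _ _) le_mn.
by rewrite (leq_trans _ le_mn) // -ltnS.
Qed.

Fact fps_mulC : commutative fps_mul.
Proof. by move=> f g; apply: fpsP => n; rewrite [LHS](@mul_trunc n) // [RHS](@mul_trunc n) // mulrC. Qed.

Fact fps_mulA : associative fps_mul.
Proof.
move=> f g h; apply: fpsP => n.
transitivity ((trunc n f * (trunc n g * trunc n h))`_n).
  rewrite coefM /=; apply: eq_bigr => i _.
  rewrite -(@mul_trunc n (n - i)) ?leq_subr //.
  by rewrite coef_poly ltn_ord.
rewrite mulrA coefM /=; apply: eq_bigr => i _.
rewrite -(@mul_trunc n i) -1?ltnS //.
by rewrite coef_poly ltnS leq_subr.
Qed.

Fact fps_mul1 : left_id fps_one fps_mul.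
Proof.
move=> f; apply: fpsP => n /=.
rewrite big_ord_recl big1 ?addr0 /= ?mul1r ?subn0 // => i _.
by rewrite mul0r.
Qed.

Fact fps_mulDl : left_distributive fps_mul fps_add.
Proof.
move=> f g h; apply: fpsP => n /=; rewrite -big_split /=.
by apply: eq_bigr => i _; rewrite mulrDl.
Qed.

Fact fps_oner_neq0 : fps_one != 0.
Proof.
apply/eqP => /(congr1 (fun f : fps K => f 0%N)) /= /eqP.
by rewrite oner_eq0.
Qed.

HB.instance Definition _ := GRing.Zmodule_isComNzRing.Build (fps K)
  fps_mulA fps_mulC fps_mul1 fps_mulDl fps_oner_neq0.

Fact fps_scaleA a b f : fps_scale a (fps_scale b f) = fps_scale (a * b) f.
Proof. by apply: fpsP => n /=; rewrite mulrA. Qed.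
Fact fps_scale1 : left_id 1 fps_scale.
Proof. by move=> f; apply: fpsP => n /=; rewrite mul1r. Qed.
Fact fps_scaleDr : right_distributive fps_scale +%R.
Proof. by move=> a f g; apply: fpsP => n /=; rewrite mulrDr. Qed.
Fact fps_scaleDl f : {morph fps_scale^~ f : a b / a + b}.
Proof. by move=> a b; apply: fpsP => n /=; rewrite mulrDl. Qed.

HB.instance Definition _ := GRing.Zmodule_isLmodule.Build K (fps K)
  fps_scaleA fps_scale1 fps_scaleDr fps_scaleDl.

Fact fps_scaleAl (a : K) f g : a *: (f * g) = (a *: f) * g.
Proof.
apply: fpsP => n /=; rewrite mulr_sumr.
by apply: eq_bigr => i _; rewrite mulrA.
Qed.

HB.instance Definition _ :=
  GRing.Lmodule_isLalgebra.Build K (fps K) fps_scaleAl.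
HB.instance Definition _ := GRing.Lalgebra_isComAlgebra.Build K (fps K).

End FpsRing.

Definition fps_monom (K : comNzRingType) (s : nat) : fps K :=
  Fps (fun n => (n == s)%:R).

(** * Numerical semigroups *)

Definition submonoid (S : set nat) : Prop :=
  S 0%N /\ forall x y, S x -> S y -> S (x + y)%N.

Record numSemigroup := NumSemigroup {
  numSemigroup_set :> set nat;
  numSemigroupP : submonoid numSemigroup_set }.

(* [g] lists the minimal system of generators of [S] in increasing order;
   the condition on the gcd amounts to the finiteness of [~` S]. *)
Definition min_generators (S : set nat) (g : seq nat) : Prop :=
  [/\ sorted ltn g,
      smallest submonoid [set` g] = S,
      forall A : set nat,
        A `<=` [set` g] -> smallest submonoid A = S -> A = [set` g] &
      \big[gcdn/0%N]_(x <- g) x = 1%N].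

(* [hfold S h] is [hM], where [M = S \ {0}]. *)
Definition hfold (S : set nat) (h : nat) : set nat :=
  if h is 0%N then S
  else [set (\sum_(i < h) m i)%N
       | m in [set m : 'I_h -> nat | forall i, (S `\ 0%N) (m i)]].

Definition blowup (S : set nat) : set int :=
  \bigcup_h [set z : int | forall l, hfold S h l ->
                           exists2 m, hfold S h m & z + l%:Z = m%:Z].

(* Least and greatest elements; the default value [x0] is used only when there
   is none, which does not happen below when [g1] is the multiplicity of [S]. *)
Definition set_min d (T : porderType d) (x0 : T) (A : set T) : T :=
  xget x0 (A `&` lbound A).
Definition set_max d (T : porderType d) (x0 : T) (A : set T) : T :=
  xget x0 (A `&` ubound A).

Section Apery.
Variables (S : set nat) (g1 : nat).

Definition omega (i : nat) : nat :=
  set_min 0%N [set s | S s /\ s = i %[mod g1]].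

Definition omega' (i : nat) : int :=
  set_min 0 [set s | blowup S s /\ (s = i%:Z %[mod g1%:Z])%Z].

Definition apery_a (i : nat) : int :=
  xget 0 [set a : int | omega' i + a * g1%:Z = (omega i)%:Z].

Definition apery_b (i : nat) : nat :=
  set_max 0%N [set l | hfold S l (omega i)].

End Apery.

(** * The semigroup ring k[[t^S]] *)

Section SemigroupRing.
Variables (K : fieldType) (S : numSemigroup).

Definition supported_in : {pred fps K} :=
  [pred f : fps K | `[< [set n | f n != 0] `<=` S >]].

Fact supported_in_subalg : GRing.subalg_closed supported_in.
Proof.
have [S0 SD] := numSemigroupP S.
split=> [|a f g|f g] /=; rewrite ?inE.
- by case=> [|n] /=; rewrite ?eqxx.
- move=> fS gS n /= nz.
  have [fn0|/fS//] := eqVneq (f n) 0; apply: gS; apply: contraNneq nz => gn0.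
  by rewrite fn0 gn0 mulr0 addr0.
- move=> fS gS n /= nz.
  apply: contrapT => nSn; move/eqP: nz; apply; apply: big1 => i _.
  have [->|/fS Si] := eqVneq (f i) 0; first by rewrite mul0r.
  have [->|/gS Sj] := eqVneq (g (n - i)%N) 0; first by rewrite mulr0.
  by case: nSn; rewrite -(subnKC (_ : i <= n)%N) -1?ltnS //; apply: SD.
Qed.

HB.instance Definition _ :=
  GRing.isSubalgClosed.Build K (fps K) supported_in supported_in_subalg.

Record semigroup_ring := SemigroupRing {
  sgr_val :> fps K;
  _ : sgr_val \in supported_in }.

HB.instance Definition _ := [isSub for sgr_val].
HB.instance Definition _ := [Choice of semigroup_ring by <:].
HB.instance Definition _ := [SubChoice_isSubComNzRing of semigroup_ring by <:].
HB.instance Definition _ :=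
  [SubZmodule_isSubLmodule of semigroup_ring by <:].
HB.instance Definition _ :=
  [SubNzRing_SubLmodule_isSubLalgebra of semigroup_ring by <:].
HB.instance Definition _ :=
  GRing.Lalgebra_isComAlgebra.Build K semigroup_ring.

End SemigroupRing.

(** * Hilbert functions *)

Section Ideals.
Variable A : comNzRingType.

Definition is_ideal (I : set A) : Prop :=
  [/\ I 0, forall x y, I x -> I y -> I (x + y) & forall a x, I x -> I (a * x)].

Definition ideal_span (X : set A) : set A := smallest is_ideal X.

(* For [h = 0] the only product is the empty one, so this is the unit ideal. *)
Definition ideal_exp (I : set A) (h : nat) : set A :=
  ideal_span [set \prod_(i < h) x i | x in [set x : 'I_h -> A | forall i, I (x i)]].

End Ideals.

(* [d] vectors of [U] form a basis of [U] modulo [W]. *)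
Definition has_quotient_dim (K : fieldType) (V : lmodType K) (U W : set V)
    (d : nat) : Prop :=
  exists v : 'I_d -> V,
    [/\ forall i, U (v i),
        forall c : 'I_d -> K, W (\sum_i c i *: v i) -> forall i, c i = 0 &
        forall u, U u -> exists c : 'I_d -> K, W (u - \sum_i c i *: v i)].

Definition quotient_dim (K : fieldType) (V : lmodType K) (U W : set V) : nat :=
  xget 0%N [set d | has_quotient_dim U W d].

Definition hilbert (K : fieldType) (A : comAlgType K) (m : set A) (h : nat) :
    nat :=
  quotient_dim (ideal_exp m h) (ideal_exp m h.+1).

Definition max_ideal (K : fieldType) (S : numSemigroup) (g : seq nat) :
    set (semigroup_ring K S) :=
  ideal_span [set x | exists2 s, s \in g & sgr_val x = fps_monom K s].
Arguments max_ideal : clear implicits.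

(* Main.v *)
Require Import Defs.
From mathcomp Require Import all_boot all_order all_algebra.
From mathcomp Require Import boolp classical_sets functions cardinality.
From mathcomp Require Import zify.
Local Open Scope classical_set_scope.
Local Open Scope card_scope.
Local Open Scope ring_scope.

(** Write M for the nonzero part of S. The ideal m^h consists of the series with
    support in hM, so H_R(h) is the number of elements of the layer
    hM \ (h+1)M: these exponents index a basis of the degree-h part of the
    tangent cone of R, on which the initial form of t^g1 acts by s |-> s + g1
    when s + g1 lies in the next layer, and by s |-> 0 otherwise. Let D be the
    set of exponents s of degree h killed in this way, and C the set of
    exponents of degree h+1 that are not reached. Then
    H_R(h+1) - H_R(h) = |C| - |D|, and one has to show |D| <= |C|.

    First, |D| <= 3. Distinct elements of a layer lie in distinct classes modulo
    g1, so it suffices that the class i of an element s of D satisfies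
    a_i > b_i (ker_layer_apery). Write s = omega_i + k g1. Since s is not in
    (h+1)M, b_i + k <= h. Since s + g1 is in (h+2)M, s + g1 - (h+2) g1 lies in
    the blow up, hence omega'_i <= omega_i - (h+1-k) g1, and
    a_i >= h+1-k > b_i. Membership in the blow up comes from
    (r+1)M = g1 + rM for large r (hfold_reduction).

    Second, |D| <= 3 implies |D| <= |C| (coker_ge_ker). The elements
    s + g1, for s in D, are unreached exponents of degrees larger than h+1, and
    none of them is another one plus an element of M. The set of unreached
    exponents is closed under removing a summand from a longest writing, so it
    behaves like the monomials of a standard graded algebra, and the claim is an
    instance of the growth bounds of Macaulay type: an antichain of at most
    three elements in degrees >= d, where d >= 2, forces at least as many
    elements in degree d. It is obtained by going down one degree at a time,
    replacing the elements of top degree by elements of their shadow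
    (coker_descent). The count that makes this possible is shadow_size: at most
    three elements of degree d+1 >= 3 have a shadow at least as large as their
    number. For h = 0 the set D is empty. *)

(** * Multiples of the maximal ideal of a semigroup *)

Section Folds.
Local Open Scope nat_scope.
Variable S : set nat.
Hypothesis S_submonoid : submonoid S.
Local Notation M := (S `\ 0).
Implicit Types (h k u v w z : nat).

Lemma nonzero_part z : M z -> S z /\ 0 < z.
Proof. by case=> Sz /eqP; rewrite -lt0n. Qed.

Lemma nonzero_partI z : S z -> 0 < z -> M z.
Proof. by move=> Sz z0; split=> //= z_eq; rewrite z_eq in z0. Qed.

(** As 0M = S, the sum of 0M and M is M, so the recursion holds from h = 0 on. *)
Lemma hfoldSP h u :
  hfold S h.+1 u <-> exists v z, [/\ hfold S h v, M z & u = v + z].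
Proof.
have [S0 SD] := S_submonoid.
case: h => [|h]; split.
- by case=> m mM <-; exists 0, (m ord0); rewrite big_ord1; split.
- case=> v [z [Sv /nonzero_part[Sz z0] ->]].
  exists (fun=> v + z); last by rewrite big_ord1.
  by move=> i /=; apply: nonzero_partI; [exact: SD | rewrite addn_gt0 z0 orbT].
- case=> m mM <-; rewrite big_ord_recr /=.
  exists (\sum_(i < h.+1) m (widen_ord (leqnSn h.+1) i)), (m ord_max).
  split=> //; last exact: mM.
  by exists (fun i => m (widen_ord (leqnSn h.+1) i)) => // i; apply: mM.
- case=> v [z [[m mM <-] Mz ->]].
  exists (fun i : 'I_h.+2 => oapp m z (unlift ord_max i)).
    by move=> i /=; case: unliftP => [j|] _ /=; [exact: mM|].
  rewrite big_ord_recr /= unlift_none /=; congr (_ + _).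
  apply: eq_bigr => i _; rewrite (_ : widen_ord _ i = lift ord_max i) ?liftK //.
  by apply: val_inj; rewrite /= /bump leqNgt ltn_ord.
Qed.

Lemma hfold_add h v z : hfold S h v -> M z -> hfold S h.+1 (v + z).
Proof. by move=> hv Mz; apply/hfoldSP; exists v, z. Qed.

Lemma hfold_sub h v : hfold S h v -> S v.
Proof.
have [_ SD] := S_submonoid.
elim: h v => // h IH v /hfoldSP[u [z [/IH Su [Sz _] ->]]]; exact: SD.
Qed.

Lemma hfold_addS h v s : hfold S h v -> S s -> hfold S h (v + s).
Proof.
have [_ SD] := S_submonoid.
elim: h v => [|h IH] v; first exact: SD.
by move=> /hfoldSP[u [z [hu Mz ->]]] Ss; rewrite addnAC; apply: hfold_add; first exact: IH.
Qed.

Lemma hfoldW h v : hfold S h.+1 v -> hfold S h v.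
Proof. by move=> /hfoldSP[u [z [hu [Sz _] ->]]]; apply: hfold_addS. Qed.

Lemma hfold_anti h k v : k <= h -> hfold S h v -> hfold S k v.
Proof.
elim: h => [|h IH]; first by rewrite leqn0 => /eqP ->.
by rewrite leq_eqVlt => /predU1P[-> //|lekh] /hfoldW; apply: IH.
Qed.

Lemma hfoldD h k u v : hfold S h u -> hfold S k v -> hfold S (h + k) (u + v).
Proof.
elim: k v => [|k IH] v hu; first by rewrite addn0; apply: hfold_addS.
move=> /hfoldSP[w [z [hw Mz ->]]].
by rewrite addnS addnA; apply: hfold_add => //; apply: IH.
Qed.

Lemma hfold_muln h z : M z -> hfold S h (h * z).
Proof.
have [S0 _] := S_submonoid.
elim: h => [|h IH] Mz //; rewrite mulSnr; apply: hfold_add => //; exact: IH.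
Qed.

Lemma hfold_ge g1 h v : (forall z, M z -> g1 <= z) -> hfold S h v -> h * g1 <= v.
Proof.
move=> g1_min; elim: h v => // h IH v /hfoldSP[u [z [/IH leu /g1_min lez ->]]].
by rewrite mulSnr leq_add.
Qed.

(** * Factors and shadows *)

(** When h+1 is the largest k with v in kM, these are the possible summands in
    the writings of v as a sum of h+1 elements of M. *)
Definition factor h v z := M z /\ exists2 u, hfold S h u & v = u + z.

Lemma factor_exists h v : hfold S h.+1 v -> exists z, factor h v z.
Proof. by move=> /hfoldSP[u [z [hu Mz ->]]]; exists z; split=> //; exists u. Qed.

Lemma factor_add h v z y : factor h v z -> M y -> factor h.+1 (v + y) z.
Proof.
move=> [Mz [u hu ->]] My; split=> //.
by exists (u + y); [exact: hfold_add | rewrite addnAC].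
Qed.

(** Removing a summand can only lose factors, so the property descends to every
    partial sum and all summands of v are equal. *)
Lemma pure_of_factors h v x : hfold S h.+1 v ->
  (forall z, factor h v z -> z = x) -> v = h.+1 * x.
Proof.
have [S0 _] := S_submonoid.
elim: h v => [|h IH] v hv vx.
  rewrite mul1n; apply: vx; split; last by exists 0.
  move/hfoldSP: hv => [u [z [hu /nonzero_part[Sz z0] ->]]].
  by apply: nonzero_partI; [exact: (proj2 S_submonoid) | rewrite addn_gt0 z0 orbT].
have [u [z [hu Mz def_v]]] := (hfoldSP h.+1 v).1 hv.
have zx : z = x by apply: vx; split=> //; exists u.
rewrite (mulSnr h.+1) def_v zx (IH u) // => y fy.
by apply: vx; rewrite def_v; apply: factor_add.
Qed.

(** The hypothesis says that the shadow of w is reduced to a. *)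
Lemma pure_of_shadow1 h a w : hfold S h.+1 w ->
    (forall z, factor h w z -> w = a + z) ->
  exists x, [/\ M x, a = h * x & w = h.+1 * x].
Proof.
move=> hw wa; have [x fx] := factor_exists _ _ hw.
have [Mx _] := fx; exists x.
have w_pure : w = h.+1 * x.
  by apply: pure_of_factors => // z fz; move: (wa z fz) (wa x fx); lia.
by split=> //; move: (wa x fx); rewrite w_pure mulSn; lia.
Qed.

(** Elements with two shadows a and b have exactly the two factors w - a and
    w - b. Factors of a and of b are factors of w and of w'. If w <> w', the pairs
    {w - a, w - b} and {w' - a, w' - b} share at most one element, and both a
    and b would be h+1 times this element. *)
Lemma mixed_unique h a b w w' : hfold S h.+1 a -> hfold S h.+1 b -> a <> b ->
    (forall z, factor h.+1 w z -> w = a + z \/ w = b + z) ->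
    (forall z, factor h.+1 w' z -> w' = a + z \/ w' = b + z) ->
    (exists2 y, M y & w = a + y) -> (exists2 x, M x & w = b + x) ->
    (exists2 y, M y & w' = a + y) -> (exists2 x, M x & w' = b + x) ->
  w = w'.
Proof.
move=> ha hb neq_ab Fw Fw' [y My wa] [x Mx wb] [y' My' wa'] [x' Mx' wb'].
apply: contrapT => neq_ww'.
have [z0 fz0] := factor_exists _ _ ha.
have fa z : factor h a z ->
    (w = a + z \/ w = b + z) /\ (w' = a + z \/ w' = b + z).
  move=> fz; split; [apply: Fw | apply: Fw']; first rewrite wa; last rewrite wa';
  exact: factor_add.
have fb z : factor h b z ->
    (w = a + z \/ w = b + z) /\ (w' = a + z \/ w' = b + z).
  move=> fz; split; [apply: Fw | apply: Fw']; first rewrite wb; last rewrite wb';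
  exact: factor_add.
have [z0w z0w'] := fa _ fz0.
have same z : (w = a + z \/ w = b + z) /\ (w' = a + z \/ w' = b + z) -> z = z0.
  by case=> zw zw'; lia.
apply: (neq_ab); rewrite (pure_of_factors h a z0 ha); last first.
  by move=> z /fa /same.
by rewrite (pure_of_factors h b z0 hb) // => z /fb /same.
Qed.

(** Here x and x' are factors of w, which has only two factors, so w is
    a + x' = b + x, or one of the two pure elements. The first case
    gives (h+1) x = (h+1) x', which contradicts a <> b. *)
Lemma pures_and_mixed h a b x x' w : M x -> M x' -> a <> b ->
    a = h.+2 * x -> b = h.+2 * x' ->
    (forall z, factor h.+2 w z -> w = a + z \/ w = b + z) ->
    (exists2 y, M y & w = a + y) -> (exists2 y, M y & w = b + y) ->
  w = h.+3 * x \/ w = h.+3 * x'.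
Proof.
move=> Mx Mx' neq_ab ax bx Fw [y My wa] [y' My' wb].
have fmul z : M z -> factor h.+1 (h.+2 * z) z.
  by move=> Mz; split=> //; exists (h.+1 * z); [exact: hfold_muln | rewrite mulSnr].
have := Fw x; rewrite {1}wa ax => /(_ (factor_add _ _ _ _ (fmul x Mx) My)).
have := Fw x'; rewrite {1}wb bx => /(_ (factor_add _ _ _ _ (fmul x' Mx') My')).
nia.
Qed.

(** The bound in iota only serves to make the enumeration finite: a summand
    obtained by removing an element of M is smaller than the whole. *)
Definition shadow h (B : seq nat) : seq nat :=
  undup [seq v <- iota 0 (\max_(w <- B) w) |
    `[< exists2 w, w \in B & exists2 z, M z & hfold S h v /\ w = v + z >]].

Lemma shadowP h B v : v \in shadow h B <->
  exists2 w, w \in B & exists2 z, M z & hfold S h v /\ w = v + z.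
Proof.
rewrite mem_undup mem_filter mem_iota /=; split=> [/andP[/asboolP]//|vB].
apply/andP; split; first exact/asboolP.
case: vB => w wB [z /nonzero_part[_ z0] [_ def_w]].
have: w <= \max_(w <- B) w by apply: leq_bigmax_seq.
lia.
Qed.

(** If the shadow were smaller it would have at most two elements a and b. Each
    w in B is then pure over a, pure over b, or mixed, that is, it has
    both a and b in its shadow, and each kind contains at most one element;
    one element of each kind is excluded by pures_and_mixed. The degree
    h+3 matters: in degree 2 the elements 2x, 2x' and x + x' may have the
    shadow {x, x'}. *)
Lemma shadow_size h B : uniq B -> size B <= 3 ->
  (forall w, w \in B -> hfold S h.+3 w) -> size B <= size (shadow h.+2 B).
Proof.
move=> uB sB hB; rewrite leqNgt; apply/negP => lt_sh.
have memsh w z : w \in B -> factor h.+2 w z -> w - z \in shadow h.+2 B /\ w = (w - z) + z.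
  move=> wB [Mz [u hu def_w]]; have -> : w - z = u by lia.
  by split=> //; apply/shadowP; exists w => //; exists z.
have hsh v : v \in shadow h.+2 B -> hfold S h.+2 v.
  by move=> /shadowP[w _ [z _ []]].
have ush : uniq (shadow h.+2 B) by exact: undup_uniq.
case def_sh: (shadow h.+2 B) lt_sh memsh hsh ush => [|a [|b [|]]] //=;
  last by move=> /leq_trans/(_ sB).
- case: B uB sB hB {def_sh} => //= w B _ _ hB _ memsh _ _.
  have wB : w \in w :: B by rewrite mem_head.
  have [z fz] := factor_exists _ _ (hB w wB).
  by have [] := memsh w z wB fz.
- case: B uB sB hB {def_sh} => [|w1 [|w2 B]] //= uB _ hB _ memsh _ _.
  have pure w : w \in [:: w1, w2 & B] ->
      exists x, [/\ M x, a = h.+2 * x & w = h.+3 * x].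
    move=> wB; apply: pure_of_shadow1; first exact: hB.
    by move=> z /(memsh _ _ wB); rewrite inE => -[/eqP<-].
  have [|x [_ ax w1x]] := pure w1; first by rewrite !inE eqxx.
  have [|y [_ ay w2y]] := pure w2; first by rewrite !inE eqxx orbT.
  by move: uB; rewrite !inE (_ : w1 = w2) ?eqxx //; nia.
- case: B uB sB hB {def_sh} => [|w1 [|w2 [|w3 [|]]]] //= uB _ hB _ memsh hsh.
  rewrite inE andbT => /eqP neq_ab.
  have ha : hfold S h.+2 a by apply: hsh; rewrite !inE eqxx.
  have hb : hfold S h.+2 b by apply: hsh; rewrite !inE eqxx orbT.
  set B := [:: w1; w2; w3] in uB hB memsh *.
  have Fw w : w \in B -> forall z, factor h.+2 w z -> w = a + z \/ w = b + z.
    move=> wB z /(memsh _ _ wB); rewrite !inE => -[/orP[] /eqP <-]; auto.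
  (* Elements with a single factor are pure; all others have both a and b in
     their shadow. *)
  pose pure c w := exists x, [/\ M x, c = h.+2 * x & w = h.+3 * x].
  pose mixed w := (exists2 y, M y & w = a + y) /\ (exists2 y, M y & w = b + y).
  have trichotomy w : w \in B -> [\/ pure a w, pure b w | mixed w].
    move=> wB; have hw := hB w wB.
    have [wa|/existsNP[z1 /not_implyP[fz1 nz1]]] :=
      pselect (forall z, factor h.+2 w z -> w = a + z).
      by constructor 1; apply: pure_of_shadow1.
    have [wb|/existsNP[z2 /not_implyP[fz2 nz2]]] :=
      pselect (forall z, factor h.+2 w z -> w = b + z).
      by constructor 2; apply: pure_of_shadow1.
    have [Mz1 _] := fz1; have [Mz2 _] := fz2.
    constructor 3; split; [exists z2 | exists z1] => //.
      by case: (Fw w wB z2 fz2).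
    by case: (Fw w wB z1 fz1).
  have pure_uniq c w w' : pure c w -> pure c w' -> w = w'.
    by move=> [x [_ cx ->]] [y [_ cy ->]]; nia.
  have mixed_uniq w w' : w \in B -> w' \in B -> mixed w -> mixed w' -> w = w'.
    move=> wB w'B [wa wb] [wa' wb'].
    exact: (mixed_unique h.+1 a b w w' ha hb neq_ab (Fw w wB) (Fw w' w'B)).
  have no_three u v w : w \in B -> pure a u -> pure b v -> mixed w -> w = u \/ w = v.
    move=> wB [x [Mx ax ->]] [y [My b_y ->]] [wa wb].
    exact: (pures_and_mixed h a b x y w Mx My neq_ab ax b_y (Fw w wB)).
  have B1 : w1 \in B by rewrite !inE eqxx.
  have B2 : w2 \in B by rewrite !inE eqxx orbT.
  have B3 : w3 \in B by rewrite !inE eqxx !orbT.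
  have [n12 n13 n23] : [/\ w1 <> w2, w1 <> w3 & w2 <> w3].
    move: uB; rewrite /= !inE negb_or andbT => /andP[/andP[/eqP ? /eqP ?] /eqP ?].
    by split.
  have P12 := pure_uniq ^~ w1 w2; have P13 := pure_uniq ^~ w1 w3.
  have P23 := pure_uniq ^~ w2 w3.
  have Q12 := mixed_uniq w1 w2 B1 B2; have Q13 := mixed_uniq w1 w3 B1 B3.
  have Q23 := mixed_uniq w2 w3 B2 B3.
  case: (trichotomy w1 B1) => t1; case: (trichotomy w2 B2) => t2;
  case: (trichotomy w3 B3) => t3;
  try (by [apply: n12; eauto | apply: n13; eauto | apply: n23; eauto]);
  match goal with
  | Pa : pure a ?u, Pb : pure b ?v, m : mixed ?w |- _ =>
    by case: (no_three u v w) => //; intuition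
  end.
Qed.

(** * Kernel and cokernel of t^g1 on the tangent cone *)

Variable g1 : nat.
Hypothesis g1_pos : M g1.
Hypothesis g1_min : forall z, M z -> g1 <= z.

(** The exponents of a basis of the degree-h part of the tangent cone. *)
Definition layer h : set nat := hfold S h `\` hfold S h.+1.

(** The exponents of degree h killed by the initial form of t^g1. *)
Definition ker_layer h : set nat :=
  [set s | layer h s /\ hfold S h.+2 (s + g1)].

(** The exponents of degree h+1 (not h) in a basis of the tangent cone modulo
    the initial form of t^g1. *)
Definition coker_layer h : set nat :=
  [set u | layer h.+1 u /\ forall v, hfold S h v -> u <> v + g1].

(** A summand inherits being unreached: if v = u + g1 with u in hM, then
    v + z = (u + z) + g1 with u + z in (h+1)M. *)
Lemma coker_layer_div h v z :
  coker_layer h.+1 (v + z) -> hfold S h.+1 v -> M z -> coker_layer h v.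
Proof.
move=> [[_ nvz] new_vz] hv Mz; split; first split=> //.
  by move=> hv'; apply: nvz; apply: hfold_add.
move=> u hu def_v; apply: (new_vz (u + z)); first exact: hfold_add.
by rewrite def_v addnAC.
Qed.

(** For divisibility in S; z = 0 is excluded, as a is comparable to itself. *)
Definition antichain (A : seq nat) :=
  forall a z, a \in A -> M z -> a + z \in A -> False.

(** Induction on the range of degrees: the elements B of top degree are
    replaced by as many elements B' of their shadow, one degree lower.
    The new set is again an antichain, because an element that divides one of
    B' divides one of B, and an element of B' cannot divide another element
    of lower or equal degree. *)
Lemma coker_descent n h A : uniq A -> size A <= 3 -> antichain A ->
    (forall a, a \in A -> exists2 k, h.+1 <= k <= h.+1 + n & coker_layer k a) ->
  exists T, [/\ uniq T, size T = size A & forall t, t \in T -> coker_layer h.+1 t].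
Proof.
elim: n A => [|n IH] A uA sA antiA ordA.
  exists A; split=> // a /ordA[k]; rewrite addn0 -eqn_leq => /eqP <-; exact.
pose top a := `[< coker_layer (h.+1 + n.+1) a >].
pose B := [seq a <- A | top a].
have memB a : a \in B -> a \in A /\ coker_layer (h.+1 + n.+1) a.
  by rewrite mem_filter => /andP[/asboolP].
have sizeA : size B + size [seq a <- A | ~~ top a] = size A.
  by rewrite !size_filter count_predC.
have sB : size B <= 3 by apply: leq_trans sA; lia.
have [B' [uB' sB' shB']] : exists B', [/\ uniq B', size B' = size B &
    forall v, v \in B' -> coker_layer (h.+1 + n) v /\
      exists2 w, w \in B & exists2 z, M z & w = v + z].
  have hB w : w \in B -> hfold S (h + n).+3 w.
    by move=> /memB[_ [[]]]; rewrite addSn addnS.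
  exists (take (size B) (shadow (h + n).+2 B)); split.
  - by rewrite take_uniq ?undup_uniq.
  - by rewrite size_takel // shadow_size // filter_uniq.
  - move=> v /mem_take/shadowP[w wB [z Mz [hv def_w]]]; split; last first.
      by exists w => //; exists z.
    have [_] := memB w wB; rewrite def_w addnS !addSn => cvz.
    exact: coker_layer_div cvz hv Mz.
have memB' v : v \in B' -> coker_layer (h.+1 + n) v by move=> /shB'[].
have lowP a : a \in [seq a <- A | ~~ top a] ->
    a \in A /\ exists2 k, h.+1 <= k <= h.+1 + n & coker_layer k a.
  rewrite mem_filter => /andP[/asboolP ntop aA]; split=> //.
  have [k /andP[lek leK] ck] := ordA a aA; exists k => //; rewrite lek /=.
  move: leK; rewrite addnS leq_eqVlt => /predU1P[def_k|//].
  by case: ntop; rewrite addnS -def_k.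
(* A common element of B' and A would lie strictly below some element of B. *)
have disj v : v \in B' -> v \in A -> False.
  by move=> /shB'[_ [w /memB[wA _] [z Mz def_w]]] vA; apply: (antiA v z) => //; rewrite -def_w.
have [| | | |T [uT sT cT]] := IH (B' ++ [seq a <- A | ~~ top a]).
- rewrite cat_uniq uB' filter_uniq // andbT; apply/hasPn => a /lowP[aA _].
  by apply/negP => /disj; apply.
- by rewrite size_cat sB' sizeA.
- move=> a z; rewrite !mem_cat => /orP[aB'|/lowP[aA [k /andP[_ lek] [[_ na] _]]]] Mz.
  + have [[[ha _] _] [w wB [y My def_w]]] := shB' a aB'.
    case/orP=> [/memB'[[_ naz] _]|/lowP[azA [k /andP[_ lek] [[_ naz] _]]]].
      by apply: naz; apply: hfold_add.
    by apply: naz; apply: (hfold_anti (h.+1 + n).+2) => //; apply: hfold_add.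
  + case/orP=> [azB'|/lowP[azA _]]; last exact: (antiA a z).
    have [_ [w /memB[wA _] [y My def_w]]] := shB' _ azB'.
    apply: (antiA a (z + y)) => //; last by rewrite addnA -def_w.
    by have [Sz z0] := nonzero_part _ Mz; have [Sy _] := nonzero_part _ My;
      apply: nonzero_partI; [exact: (proj2 S_submonoid) | rewrite addn_gt0 z0].
- move=> a; rewrite mem_cat => /orP[/memB' ca|/lowP[] //].
  by exists (h.+1 + n) => //; rewrite leqnn leq_addr.
- by exists T; split=> //; rewrite sT size_cat sB' sizeA.
Qed.

(** Were s + g1 = v + g1 with v in kM and k > h, then s = v would be in
    (h+1)M. *)
Lemma ker_layer_shift h s : ker_layer h s ->
  exists2 k, h < k & coker_layer k (s + g1).
Proof.
move=> [[hs ns] hs2].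
have bounded k : `[< hfold S k (s + g1) >] -> k <= s + g1.
  move=> /asboolP hk; rewrite -[k]muln1; apply: hfold_ge hk.
  by move=> z /nonzero_part[].
have ex : exists k, `[< hfold S k (s + g1) >] by exists h.+2; apply/asboolP.
case: (ex_maxnP ex bounded) => K /asboolP hK maxK.
have leK : h.+2 <= K by apply: maxK; apply/asboolP.
case: K hK maxK leK => // k hk maxk ltk; exists k => //; split; first split=> //.
  by move=> hk'; have := maxk k.+2; rewrite ltnn => /(_ (asboolT hk')).
move=> v hv /addIn def_s; apply: ns; rewrite def_s.
by apply: hfold_anti hv.
Qed.

(** Adding an element of M raises the order, so the exponents of a layer form an
    antichain, and so do their translates by g1. *)
Lemma coker_ge_ker h D : uniq D -> size D <= 3 ->
    (forall s, s \in D -> ker_layer h.+1 s) ->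
  exists T, [/\ uniq T, size T = size D & forall t, t \in T -> coker_layer h.+1 t].
Proof.
move=> uD sD kD.
pose A := [seq s + g1 | s <- D].
have uA : uniq A by rewrite map_inj_uniq // => x y /addIn.
have ordA a : a \in A -> exists2 k, h.+1 < k & coker_layer k a.
  by move=> /mapP[s /kD/ker_layer_shift kA ->].
(* An element of kM is at least k, so N bounds the degrees that occur. *)
pose N := \max_(a <- A) a.
rewrite -(size_map (addn^~ g1) D) -/A.
apply: (coker_descent N) => //; first by rewrite size_map.
  move=> _ z /mapP[s /kD[[hs _] _] ->] Mz /mapP[t /kD[[_ nt] _]].
  rewrite addnAC => /addIn def_t; apply: nt; rewrite -def_t; exact: hfold_add.
move=> a aA; have [k ltk ck] := ordA a aA; exists k => //.
rewrite (ltnW ltk) /=; have [[hk _] _] := ck.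
have := hfold_ge 1 k.+1 a (fun z Mz => proj2 (nonzero_part z Mz)) hk.
have : a <= N by apply: leq_bigmax_seq.
lia.
Qed.

Lemma ker_layer0 s : ~ ker_layer 0 s.
Proof.
move=> [[Ss ns] hs2]; apply: ns.
have [S0 _] := S_submonoid; have [s0|s0] := posnP s; last first.
  by apply/hfoldSP; exists 0, s; split=> //; apply: nonzero_partI.
have [_ g10] := nonzero_part _ g1_pos.
by have := hfold_ge g1 2 _ g1_min hs2; rewrite s0; lia.
Qed.

(** Adding g1 raises the order, so a class modulo g1 leaves hM \ (h+1)M after
    its first element. *)
Lemma layer_inj_mod h u v : layer h u -> layer h v -> u = v %[mod g1] -> u = v.
Proof.
have aux u' v' : u' < v' -> layer h u' -> layer h v' -> u' = v' %[mod g1] -> False.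
  move=> ltuv [hu _] [_ nv] /esym/eqP; rewrite eqn_mod_dvd ?(ltnW ltuv) // => /dvdnP[q def_q].
  have q0 : 0 < q by case: q def_q => //; lia.
  apply: nv; have -> : v' = u' + q * g1 by lia.
  apply: (hfold_anti (h + q)); first by rewrite -addn1 leq_add2l.
  by apply: hfoldD => //; apply: hfold_muln.
move=> lu lv uv; case: (ltngtP u v) => // lt_uv; first by case: (aux u v).
by case: (aux v u).
Qed.

Lemma layer_enum h : exists s, uniq s /\ forall u, layer h u <-> u \in s.
Proof.
have [_ g10] := nonzero_part _ g1_pos.
have /finite_seqP[s def_s] : finite_set (layer h).
  apply/finite_set_leP; exists g1; apply/pcard_leP/injfunPex; exists (modn^~ g1).
    by move=> u _ /=; rewrite ltn_mod.
  by move=> u v /set_mem lu /set_mem lv; apply: layer_inj_mod lu lv.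
exists (undup s); split; first exact: undup_uniq.
by move=> u; rewrite mem_undup def_s.
Qed.

(** Translation by g1 embeds the part of the layer outside the kernel in the
    next layer, where it avoids the cokernel; the cokernel makes up for the
    kernel. *)
Lemma layer_size_le h sh sh1 : uniq sh -> uniq sh1 ->
    (forall u, layer h u <-> u \in sh) -> (forall u, layer h.+1 u <-> u \in sh1) ->
    (forall D, uniq D -> (forall s, s \in D -> ker_layer h s) -> size D <= 3) ->
  size sh <= size sh1.
Proof.
move=> ush ush1 shP sh1P kerS.
pose inker s := `[< hfold S h.+2 (s + g1) >].
pose D := [seq s <- sh | inker s].
have uD : uniq D by rewrite filter_uniq.
have kerD s : s \in D -> ker_layer h s.
  by rewrite mem_filter => /andP[/asboolP hs2 /shP].
have [T [uT sT cT]] : exists T,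
    [/\ uniq T, size T = size D & forall t, t \in T -> coker_layer h t].
  have sD := kerS D uD kerD.
  case: h @inker @D uD kerD sD {sh1P shP kerS} => [|h] inker D uD kerD sD.
    exists [::]; split=> //; case: D uD kerD {sD} => // s D _.
    by move=> /(_ s (mem_head _ _))/ker_layer0.
  exact: coker_ge_ker.
have -> : size sh = size ([seq s + g1 | s <- sh & ~~ inker s] ++ T).
  by rewrite size_cat size_map sT !size_filter addnC count_predC.
apply: uniq_leq_size.
  rewrite cat_uniq uT map_inj_uniq ?filter_uniq //=; last by move=> x y /addIn.
  rewrite andbT; apply/hasPn => t /cT[_ new_t]; apply/mapP => -[s].
  by rewrite mem_filter => /andP[_ /shP[hs _]]; apply: new_t.
move=> t; rewrite mem_cat => /orP[/mapP[s]|/cT[/sh1P] //].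
rewrite mem_filter => /andP[/asboolP ns /shP[hs _]] ->.
by apply/sh1P; split=> //; apply: hfold_add.
Qed.

(** * The blow up and the Apery invariants *)

Lemma hfold_sum h u : hfold S h.+1 u ->
  exists m, (forall i, M (m i)) /\ u = \sum_(0 <= i < h.+1) m i.
Proof.
move=> [m mM <-]; exists (fun i => m (inord i)); split=> [i|]; first exact: mM.
by rewrite big_mkord; apply: eq_bigr => i _; rewrite inord_val.
Qed.

Lemma sum_hfold (m : nat -> nat) j k : j <= k -> (forall i, M (m i)) ->
  hfold S (k - j) (\sum_(j <= i < k) m i).
Proof.
move=> lejk mM; rewrite -(subnKC lejk); move: (k - j) => {lejk} n.
rewrite addKn; elim: n => [|n IH]; first by rewrite addn0 big_geq //; case: S_submonoid.
by rewrite addnS big_nat_recr ?leq_addr //=; apply: hfold_add.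
Qed.

(** Two of the first g1 + 1 partial sums of u = m_0 + ... + m_h are congruent
    modulo g1, so a block of consecutive summands adds up to q g1. As
    each summand is at least g1, q is at least the length of the block, and
    replacing the block by q copies of g1 does not shorten the sum. *)
Lemma hfold_reduction h u :
  g1 <= h -> hfold S h.+1 u -> exists2 v, hfold S h v & u = v + g1.
Proof.
move=> le_g1h /hfold_sum[m [mM ->]].
have [_ g10] := nonzero_part _ g1_pos.
pose P j := \sum_(0 <= i < j) m i.
have [j [k [ltjk lek eq_P]]] : exists j k, [/\ j < k, k <= g1 & P j = P k %[mod g1]].
  pose r (j : 'I_g1.+1) : 'I_g1 := Ordinal (ltn_pmod (P j) g10).
  have /injectivePn[x [y neq_xy /(congr1 val) /= eq_r]] : ~~ injectiveb r.
    by apply/injectiveP => /leq_card; rewrite !card_ord ltnn.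
  have lex := ltn_ord x; have ley := ltn_ord y.
  case: (ltngtP x y) => [ltxy|ltyx|/val_inj eq_xy]; last by rewrite eq_xy eqxx in neq_xy.
  - by exists x, y.
  - by exists y, x.
have catP i n : i <= n -> P n = P i + \sum_(i <= l < n) m l.
  by move=> le_in; rewrite /P -big_cat_nat.
have [q def_q] : exists q, \sum_(j <= i < k) m i = q * g1.
  apply/dvdnP; move/esym/eqP: eq_P.
  by rewrite eqn_mod_dvd (catP j k (ltnW ltjk)) ?leq_addr // addKn.
have leq : k - j <= q.
  have := hfold_ge g1 _ _ g1_min (sum_hfold m j k (ltnW ltjk) mM).
  by rewrite def_q leq_pmul2r.
rewrite -/(P h.+1) (catP k) ?(catP j k) ?def_q; try lia.
exists (P j + (q.-1 * g1 + \sum_(k <= l < h.+1) m l)); last first.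
  have -> : q = q.-1.+1 by lia.
  rewrite mulSn /=; lia.
apply: (hfold_anti (j + (q.-1 + (h.+1 - k)))); first by lia.
apply: hfoldD; first by rewrite -{1}[j]subn0; apply: sum_hfold.
by apply: hfoldD; [apply: hfold_muln | apply: sum_hfold => //; lia].
Qed.

(** For l in rM with r = g1, the sum l + u is in (r+j)M, from which the copies
    of g1 can be split off j times without leaving rM. *)
Lemma blowup_sub j u : hfold S j u -> blowup S (u%:Z - (j * g1)%:Z)%R.
Proof.
move=> hu; exists g1 => //= l hl.
have red n w : hfold S (g1 + n) w -> exists2 v, hfold S g1 v & w = v + n * g1.
  elim: n w => [|n IH] w; first by rewrite addn0 => hw; exists w; rewrite ?addn0.
  rewrite addnS => /hfold_reduction[|v /IH[v' hv' ->] ->]; first exact: leq_addr.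
  by exists v' => //; rewrite mulSn; lia.
have [v hv def_v] := red j (l + u) (hfoldD _ _ _ _ hl hu).
by exists v => //; lia.
Qed.

(** A negative z could not map the least element of hM into hM. *)
Lemma blowup_ge0 (z : int) : blowup S z -> (0 <= z)%R.
Proof.
move=> [h _ zh].
have ex : exists l, `[< hfold S h l >].
  by exists (h * g1); apply/asboolP; apply: hfold_muln.
case: (ex_minnP ex) => l /asboolP hl minl.
have [m hm def_m] := zh l hl.
have : l <= m by apply: minl; apply/asboolP.
lia.
Qed.

Lemma set_minP d (T : porderType d) (x0 : T) (A : set T) :
  (exists x, A x /\ forall y, A y -> (x <= y)%O) ->
  A (set_min x0 A) /\ forall y, A y -> (set_min x0 A <= y)%O.
Proof. by move=> /(xgetPex x0). Qed.

Lemma set_maxP d (T : porderType d) (x0 : T) (A : set T) :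
  (exists x, A x /\ forall y, A y -> (y <= x)%O) ->
  A (set_max x0 A) /\ forall y, A y -> (y <= set_max x0 A)%O.
Proof. by move=> /(xgetPex x0). Qed.

Lemma omegaP s (i := s %% g1) : S s ->
  [/\ S (omega S g1 i), omega S g1 i = s %[mod g1] & omega S g1 i <= s].
Proof.
move=> Ss.
have ex : exists s, `[< S s /\ s = i %[mod g1] >].
  by exists s; apply/asboolP; rewrite modn_mod.
have [|[So eq_o] le_o] := set_minP _ nat 0 [set s | S s /\ s = i %[mod g1]].
  case: (ex_minnP ex) => m /asboolP mA minm; exists m; split=> // y yA.
  by rewrite leEnat; apply: minm; apply/asboolP.
split=> //; first by rewrite eq_o modn_mod.
by have := le_o s; rewrite leEnat; apply; rewrite /= modn_mod.
Qed.

Lemma omega'P (i : nat) (z : int) : blowup S z -> (z = i%:Z %[mod g1%:Z])%Z ->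
  [/\ blowup S (omega' S g1 i), (omega' S g1 i = i%:Z %[mod g1%:Z])%Z
    & (omega' S g1 i <= z)%R].
Proof.
move=> bz eqz; set A := [set s | blowup S s /\ (s = i%:Z %[mod g1%:Z])%Z].
have Az : A z by [].
have ex : exists n : nat, `[< A n%:Z >].
  by exists `|z|%N; apply/asboolP; rewrite gez0_abs // blowup_ge0.
have [|[bo eq_o] le_o] := set_minP _ int 0%R A.
  case: (ex_minnP ex) => m /asboolP mA minm; exists m%:Z; split=> // y yA.
  have y0 := blowup_ge0 y (proj1 yA).
  by rewrite -(gez0_abs y0) lez_nat; apply: minm; apply/asboolP; rewrite gez0_abs.
by split=> //; apply: le_o.
Qed.

Lemma apery_bP s (i := s %% g1) :
  S s -> hfold S (apery_b S g1 i) (omega S g1 i).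
Proof.
move=> /omegaP[So _ _]; set o := omega S g1 i in So *.
have ex : exists l, `[< hfold S l o >] by exists 0; apply/asboolP.
have bounded l : `[< hfold S l o >] -> l <= o.
  move=> /asboolP hl; rewrite -[l]muln1; apply: hfold_ge hl.
  by move=> z /nonzero_part[].
have [|hb _] := @set_maxP _ nat 0 [set l | hfold S l o]; last exact: hb.
case: (ex_maxnP ex bounded) => l /asboolP hl maxl; exists l; split=> // k hk.
by rewrite leEnat; apply: maxl; apply/asboolP.
Qed.

Lemma apery_aP (i : nat) (z : int) : blowup S z -> (z = i%:Z %[mod g1%:Z])%Z ->
  (omega S g1 i = i %[mod g1]) ->
  (omega' S g1 i + apery_a S g1 i * g1%:Z = (omega S g1 i)%:Z)%R.
Proof.
move=> bz /(omega'P i z bz)[_ eq_o' _] eq_o.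
apply: (@xgetPex _ 0%R [set a : int | omega' S g1 i + a * g1%:Z = (omega S g1 i)%:Z]%R).
have /eqP : ((omega S g1 i)%:Z = omega' S g1 i %[mod g1%:Z])%Z.
  by rewrite eq_o' !modz_nat eq_o.
by rewrite eqz_mod_dvd => /dvdzP[a def_a]; exists a; rewrite /= -def_a; lia.
Qed.

(** With s = omega_i + k g1, the fact that s is not in (h+1)M gives
    b_i + k <= h, and s + g1 in (h+2)M gives omega'_i <= s + g1 - (h+2) g1. *)
Lemma ker_layer_apery h s (i := s %% g1) : ker_layer h s ->
  ((apery_b S g1 i)%:Z < apery_a S g1 i)%R.
Proof.
move=> [[hs ns] hs2]; have Ss := hfold_sub _ _ hs.
have [_ g10] := nonzero_part _ g1_pos.
have [So eq_o le_o] := omegaP s Ss.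
have hb := apery_bP s Ss; rewrite -/i in So eq_o le_o hb.
have [k def_k] : exists k, s = omega S g1 i + k * g1.
  move/esym/eqP: eq_o; rewrite eqn_mod_dvd // => /dvdnP[k def_k].
  by exists k; lia.
have lebk : apery_b S g1 i + k <= h.
  rewrite leqNgt; apply/negP => lt_h; apply: ns.
  by apply: (hfold_anti _ _ _ lt_h); rewrite def_k; apply: hfoldD => //; apply: hfold_muln.
have bz := blowup_sub _ _ hs2.
have eqz : (((s + g1)%:Z - (h.+2 * g1)%:Z)%R = i%:Z %[mod g1%:Z])%Z.
  apply/eqP; rewrite eqz_mod_dvd.
  have [q def_s] : exists q, s = q * g1 + i by exists (s %/ g1); apply: divn_eq.
  have -> : ((s + g1)%:Z - (h.+2 * g1)%:Z - i%:Z = (q%:Z - h%:Z - 1) * g1%:Z)%R.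
    by clear -def_s; clearbody i; lia.
  exact: dvdz_mull.
have eq_oi : omega S g1 i = i %[mod g1] by rewrite eq_o modn_mod.
have [_ _ le_o'] := omega'P i _ bz eqz.
have def_a := apery_aP i _ bz eqz eq_oi.
nia.
Qed.

(** Exponents in the kernel are determined by their class modulo g1, hence by
    the Apery element of that class. *)
Lemma ker_layer_size h (D : seq nat) :
  ([set omega S g1 i | i in
     [set i : nat | (i < g1)%N /\ ((apery_b S g1 i)%:Z < apery_a S g1 i)%R]] #<= `I_3)%card ->
  uniq D -> (forall s, s \in D -> ker_layer h s) -> size D <= 3.
Proof.
move=> /pcard_leP/injfunPex[f fI3 f_inj] uD kD.
have [_ g10] := nonzero_part _ g1_pos.
pose o s := omega S g1 (s %% g1).
have So s : s \in D -> S s by move=> /kD[[hs _] _]; apply: hfold_sub hs.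
have oA s : s \in D -> [set omega S g1 i | i in
     [set i : nat | (i < g1)%N /\ ((apery_b S g1 i)%:Z < apery_a S g1 i)%R]] (o s).
  move=> sD; exists (s %% g1) => //; split; first by rewrite ltn_mod.
  exact: ker_layer_apery (kD s sD).
rewrite -(size_map (f \o o)) -(size_iota 0 3); apply: uniq_leq_size.
  rewrite map_inj_in_uniq // => s t sD tD /= eq_f.
  have eq_o : o s = o t by apply: f_inj eq_f; apply/mem_set; apply: oA.
  have [ls _] := kD s sD; have [lt _] := kD t tD.
  apply: layer_inj_mod ls lt _.
  have [_ <- _] := omegaP s (So s sD); have [_ <- _] := omegaP t (So t tD).
  by rewrite -/(o s) eq_o.
by move=> _ /mapP[s sD ->]; rewrite mem_iota /=; apply: fI3; apply: oA.
Qed.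

End Folds.

(** * Generators *)

Section Generators.
Local Open Scope nat_scope.
Variables (S : set nat) (g : seq nat).
Hypothesis S_submonoid : submonoid S.
Hypothesis g_min : min_generators S g.

Lemma generator_in x : x \in g -> S x.
Proof.
have [_ <- _ _] := g_min.
exact: (@sub_gen_smallest _ submonoid [set` g]).
Qed.

Lemma generator_split z : S z -> z <> 0 ->
  exists x s, [/\ x \in g, S s & z = x + s].
Proof.
have [S0 _] := S_submonoid; have [_ def_S _ _] := g_min.
pose T := [set z | z = 0 \/ exists x s, [/\ x \in g, S s & z = x + s]].
suff ST : S `<=` T by move=> /ST[].
rewrite -{1}def_S; apply: smallest_sub; last first.
  by move=> x /= gx; right; exists x, 0; rewrite addn0.
split=> [|x y]; first by left.
move=> [-> //|[x' [s [gx' Ss ->]]]] Ty; right; exists x', (s + y); rewrite addnA.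
have [_ SD] := S_submonoid; split=> //; apply: (SD) => //.
case: Ty => [-> //|[y' [s' [/generator_in Sy' Ss' ->]]]]; exact: SD.
Qed.

(** Removing 0 from a set does not change the submonoid that it generates, so
    minimality excludes 0. *)
Lemma generator_neq0 : 0 \notin g.
Proof.
have [_ def_S minS _] := g_min.
have A_g : [set` g] `\ 0 = [set` g].
  apply: minS; first exact: subDsetl.
  apply/seteqP; split.
    by apply: smallest_sub => // x [/generator_in].
  rewrite -{1}def_S => z gz T [Tmon AT]; apply: gz; split=> // x gx.
  by have [->|x0] := pselect (x = 0); [case: Tmon | apply: AT].
apply/negP => g0; have [_] : ([set` g] `\ 0) 0 by rewrite A_g.
exact.
Qed.

Lemma head_generator : (S `\ 0) (head 0 g).
Proof.
have [_ _ _ gcd1] := g_min.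
case: g gcd1 generator_neq0 generator_in => [|x s] /=; first by rewrite big_nil.
move=> _; rewrite inE negb_or => /andP[/eqP x0 _] gS; split; last exact/nesym.
by apply: gS; rewrite mem_head.
Qed.

Lemma head_generator_min z : (S `\ 0) z -> head 0 g <= z.
Proof.
have [srt _ _ _] := g_min.
move=> [Sz z0]; have [x [s [gx _ ->]]] := generator_split _ Sz z0.
apply: leq_trans (leq_addr _ _).
case: g srt gx => // y g' /= /(order_path_min ltn_trans)/allP gt_y.
by rewrite inE => /predU1P[-> //|/gt_y /ltnW].
Qed.

End Generators.

(** * Powers of the maximal ideal and the Hilbert function *)

Section Ring.
Import GRing.Theory.
Variables (K : fieldType) (S : numSemigroup).
Local Notation R := (semigroup_ring K S).
Local Notation M := ((S : set nat) `\ 0%N).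

Definition sgr_of (f : fps K) : R := insubd 0 f.

Lemma sgr_ofK (f : fps K) : (forall n, f n != 0 -> (S : set nat) n) -> sgr_val (sgr_of f) = f.
Proof.
move=> fS; rewrite /sgr_of.
have Pf : f \in supported_in S by apply: asboolT => n; apply: fS.
exact: (insubdK (0 : R) Pf).
Qed.

Definition sgr_monom s : R := sgr_of (fps_monom K s).

Lemma sgr_monomE s n : (S : set nat) s -> sgr_monom s n = (n == s)%:R.
Proof.
move=> Ss; rewrite /sgr_monom sgr_ofK // => k /=.
by case: (k =P s) => [-> //|]; rewrite eqxx.
Qed.

Lemma sgr_supp (f : R) n : f n != 0 -> (S : set nat) n.
Proof. by have /asboolP fS := valP f; apply: fS. Qed.

Lemma sgr_coefD (x y : R) n : (x + y) n = x n + y n.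
Proof. by []. Qed.

Lemma sgr_coefB (x y : R) n : (x - y) n = x n - y n.
Proof. by []. Qed.

Lemma sgr_coefM (x y : R) n : (x * y) n = \sum_(i < n.+1) x i * y (n - i)%N.
Proof. by []. Qed.

Lemma sgr_coef_sum (I : Type) (r : seq I) (P : pred I) (F : I -> R) n :
  (\sum_(i <- r | P i) F i) n = \sum_(i <- r | P i) F i n.
Proof. exact: (big_morph (fun x : R => x n)). Qed.

Lemma sgrP (x y : R) : (forall n, x n = y n) -> x = y.
Proof. by move=> xy; apply: val_inj; apply: fpsP. Qed.

Lemma sgr_monomM s (f : R) n : (S : set nat) s ->
  (sgr_monom s * f) n = if (s <= n)%N then f (n - s)%N else 0.
Proof.
move=> Ss; rewrite sgr_coefM; case: leqP => [le_sn|lt_ns].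
  rewrite (bigD1 (Ordinal (le_sn : (s < n.+1)%N))) //= sgr_monomE // eqxx mul1r.
  rewrite big1 ?addr0 // => i ne_is; rewrite sgr_monomE // -(inj_eq val_inj) in ne_is *.
  by rewrite (negPf ne_is) mul0r.
rewrite big1 // => i _; rewrite sgr_monomE //; case: eqP => [def_i|]; last by rewrite mul0r.
by have := ltn_ord i; rewrite def_i ltnS leqNgt lt_ns.
Qed.

Lemma sgr_monomD s t : (S : set nat) s -> (S : set nat) t ->
  sgr_monom (s + t)%N = sgr_monom s * sgr_monom t.
Proof.
move=> Ss St; have Sst := (numSemigroupP S).2 s t Ss St; apply: sgrP => n.
rewrite sgr_monomM // sgr_monomE // sgr_monomE //.
case: leqP => [le_sn|lt_ns].
  by congr (_%:R); lia.
by case: eqP => // def_n; lia.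
Qed.

(** This turns out to be m^h, see ideal_expE. *)
Definition fold_ideal h : set R := [set f | forall n, f n != 0 -> hfold S h n].

Lemma fold_ideal_is_ideal h : is_ideal (fold_ideal h).
Proof.
split=> [n|x y Fx Fy n|a x Fx n]; first by rewrite eqxx.
  rewrite sgr_coefD; have [->|/Fx //] := eqVneq (x n) 0.
  by rewrite add0r; apply: Fy.
apply: contra_neqP => nn; rewrite sgr_coefM big1 // => i _.
have [->|/sgr_supp Si] := eqVneq (a i) 0; first by rewrite mul0r.
have [->|/Fx hj] := eqVneq (x (n - i)%N) 0; first by rewrite mulr0.
case: nn; rewrite -(subnK (_ : i <= n)%N) -1?ltnS //.
exact: (hfold_addS _ (numSemigroupP S)).
Qed.

Lemma fold_idealM h k x y :
  fold_ideal h x -> fold_ideal k y -> fold_ideal (h + k) (x * y).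
Proof.
move=> Fx Fy n; apply: contra_neqP => nn; rewrite sgr_coefM big1 // => i _.
have [->|/Fx hi] := eqVneq (x i) 0; first by rewrite mul0r.
have [->|/Fy hj] := eqVneq (y (n - i)%N) 0; first by rewrite mulr0.
case: nn; rewrite -(subnKC (_ : i <= n)%N) -1?ltnS //.
exact: (hfoldD _ (numSemigroupP S)).
Qed.

Lemma ideal_span_is_ideal (A : comNzRingType) (X : set A) : is_ideal (ideal_span X).
Proof.
split=> [I [[]] //|x y Xx Xy I IX|a x Xx I IX].
  by have [[_ ID _] _] := IX; apply: ID; [apply: Xx | apply: Xy].
by have [[_ _ IM] _] := IX; apply: IM; apply: Xx.
Qed.

Lemma is_ideal_sum (A : comNzRingType) (J : set A) (I : Type) (r : seq I)
    (P : pred I) (F : I -> A) :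
  is_ideal J -> (forall i, P i -> J (F i)) -> J (\sum_(i <- r | P i) F i).
Proof. by move=> [J0 JD _] JF; apply: big_ind. Qed.

Variable g : seq nat.
Hypothesis g_min : min_generators S g.
Local Notation m := (max_ideal K S g).

Let S_submonoid := numSemigroupP S.
Let g1_pos := head_generator S g S_submonoid g_min.

Lemma max_ideal_sub : m `<=` fold_ideal 1.
Proof.
apply: smallest_sub; first exact: fold_ideal_is_ideal.
move=> x [s sg def_x] n; rewrite def_x /=; case: (n =P s) => [-> _|]; last by rewrite eqxx.
apply/hfoldSP => //; exists 0%N, s; rewrite add0n; split=> //; first by case: S_submonoid.
split; first exact: generator_in sg.
by move=> s0; have := generator_neq0 S g S_submonoid g_min; rewrite -s0 sg.
Qed.

Lemma ideal_exp_sub h : ideal_exp m h `<=` fold_ideal h.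
Proof.
apply: smallest_sub; first exact: fold_ideal_is_ideal.
move=> _ [x xm <-]; elim: h x xm => [|h IH] x xm.
  by rewrite big_ord0 => n; apply: sgr_supp.
rewrite big_ord_recr; have -> : fold_ideal h.+1 = fold_ideal (h + 1) by rewrite addn1.
apply: fold_idealM; last by apply: max_ideal_sub; apply: xm.
by apply: IH => i; apply: xm.
Qed.

Lemma sgr_monom_max z : M z -> m (sgr_monom z).
Proof.
move=> [Sz z0]; have [x [s [gx Ss ->]]] := generator_split S g S_submonoid g_min z Sz z0.
have Sx := generator_in S g g_min x gx.
rewrite addnC sgr_monomD //; have [_ _ mM] := ideal_span_is_ideal R
  [set x | exists2 s, s \in g & sgr_val x = fps_monom K s].
apply: mM; apply: sub_gen_smallest; exists x => //.
by apply: fpsP => n; rewrite sgr_monomE.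
Qed.

Lemma sgr_monom_exp h u : hfold S h u -> ideal_exp m h (sgr_monom u).
Proof.
move=> hu; suff [a [x [xm ->]]] : exists a (x : 'I_h -> R),
    (forall i, m (x i)) /\ sgr_monom u = a * \prod_(i < h) x i.
  have [_ _ eM] := ideal_span_is_ideal R
    [set \prod_(i < h) x i | x in [set x : 'I_h -> R | forall i, m (x i)]].
  by apply: eM; apply: sub_gen_smallest; exists x.
elim: h u hu => [|h IH] u.
  by move=> Su; exists (sgr_monom u), (fun=> 0); split=> [[]//|]; rewrite big_ord0 mulr1.
move=> /(hfoldSP _ S_submonoid)[v [z [hv Mz ->]]].
have Sv := hfold_sub _ S_submonoid _ _ hv; have [Sz _] := Mz.
have [a [x [xm def_v]]] := IH v hv.
exists a, (fun i => oapp x (sgr_monom z) (unlift ord_max i)); split=> [i|].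
  by case: unliftP => [j|] _ /=; [apply: xm | apply: sgr_monom_max].
rewrite sgr_monomD // def_v big_ord_recr /= unlift_none /= -mulrA; congr (a * (_ * _)).
apply: eq_bigr => i _; rewrite (_ : widen_ord _ i = lift ord_max i) ?liftK //.
by apply: val_inj; rewrite /= /bump leqNgt ltn_ord.
Qed.

(** Such an f is a single monomial t^e, where e is the order of f, times
    a series in t^g1; the exponent e lies in hM because f has a
    nonzero coefficient there. *)
Lemma class_ideal_exp h i (f : R) : fold_ideal h f ->
  (forall n, f n != 0 -> n = i %[mod head 0%N g]) -> ideal_exp m h f.
Proof.
move=> Ff fi; have [e0 _ eM] := ideal_span_is_ideal R
  [set \prod_(i < h) x i | x in [set x : 'I_h -> R | forall i, m (x i)]].
have [->|/eqP f0] := pselect (f = 0); first exact: e0.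
have ex : exists n, f n != 0.
  apply: contrapT => /forallNP f00; case/eqP: f0; apply: sgrP => n.
  by apply/eqP; apply: contrapT => /negP/f00.
case: (ex_minnP ex) => e fe mine.
pose q := sgr_of (Fps (fun n => f (n + e)%N)).
have [S0 _] := S_submonoid.
have Se := sgr_supp f e fe.
have qE n : q n = f (n + e)%N.
  rewrite /q sgr_ofK //= => k fke.
  have : k + e = e %[mod head 0%N g] by rewrite (fi _ fke) (fi _ fe).
  move/eqP; rewrite eqn_mod_dvd ?leq_addl // addnK => /dvdnP[c ->].
  exact: (hfold_sub _ S_submonoid _ _ (hfold_muln _ S_submonoid c _ g1_pos)).
have -> : f = q * sgr_monom e.
  apply: sgrP => n; rewrite mulrC sgr_monomM // qE; case: leqP => [/subnK -> //|lt_ne].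
  by apply/eqP; apply: contraLR lt_ne => /mine; rewrite -leqNgt.
apply: eM; apply: sgr_monom_exp; exact: Ff.
Qed.

(** Infinite sums of monomials are not available in an ideal generated
    algebraically; splitting f along the residue classes modulo g1 writes
    it as a finite sum of elements of m^h. *)
Lemma ideal_expE h : ideal_exp m h = fold_ideal h.
Proof.
apply/seteqP; split=> [|f Ff]; first exact: ideal_exp_sub.
set g1 := head 0%N g in (g1_pos) *.
have [Sg1 /eqP] := g1_pos; rewrite -lt0n => g10.
pose part (i : 'I_g1) := sgr_of (Fps (fun n => if (n %% g1)%N == i then f n else 0)).
have partE i n : part i n = if (n %% g1)%N == i then f n else 0.
  rewrite /part sgr_ofK // => k /=.
  by case: ((k %% g1)%N =P i) => _; [exact: sgr_supp | rewrite eqxx].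
have -> : f = \sum_i part i.
  apply: sgrP => n; rewrite sgr_coef_sum.
  rewrite (bigD1 (Ordinal (ltn_pmod n g10))) //= partE eqxx big1 ?addr0 // => i ne_i.
  by rewrite partE ifN // eq_sym.
apply: is_ideal_sum; first exact: ideal_span_is_ideal.
move=> i _; apply: (class_ideal_exp _ i) => n; rewrite partE;
  case: ((n %% g1)%N =P i) => [def_i|]; rewrite ?eqxx //.
  exact: Ff.
by rewrite -def_i modn_mod.
Qed.

(** The coefficients on the layer are thus coordinates on the quotient. *)
Lemma fold_ideal_layer h s (u : R) : (forall n, layer S h n <-> n \in s) ->
  fold_ideal h u -> fold_ideal h.+1 u <-> forall j : 'I_(size s), u (nth 0%N s j) = 0.
Proof.
move=> sP Fu; split=> [Fu1 j|u0 n un].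
  apply/eqP; apply: contrapT => /negP/Fu1.
  by have /sP[] : nth 0%N s j \in s by apply: mem_nth.
apply: contrapT => nn; have /sP/(nthP 0%N)[j ltj def_n] : layer S h n by split=> //; apply: Fu.
by move: un; rewrite -def_n (u0 (Ordinal ltj)) eqxx.
Qed.

(** The monomials with exponent in the layer form a basis. The number chosen
    in the definition of quotient_dim is pinned down because the coordinates of
    any other basis form a matrix A with independent rows that span, hence
    a square matrix. *)
Lemma quotient_dim_fold h s : uniq s -> (forall n, layer S h n <-> n \in s) ->
  quotient_dim (fold_ideal h) (fold_ideal h.+1) = size s.
Proof.
move=> us sP; set n := size s; have [F0 FD FM] := fold_ideal_is_ideal h.
have FZ c x : fold_ideal h x -> fold_ideal h (c *: x).
  by move=> Fx; rewrite -[x]mul1r scalerAl; apply: FM.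
have Fsum d (c : 'I_d -> K) (v : 'I_d -> R) :
    (forall i, fold_ideal h (v i)) -> fold_ideal h (\sum_i c i *: v i).
  by move=> Fv; apply: is_ideal_sum => [|i _]; [split | apply: FZ].
have FB x y : fold_ideal h x -> fold_ideal h y -> fold_ideal h (x - y).
  by move=> Fx Fy; apply: FD => //; rewrite -mulN1r; apply: FM.
have layer_nth (j : 'I_n) : layer S h (nth 0%N s j) by apply/sP; apply: mem_nth.
have S_nth (j : 'I_n) : (S : set nat) (nth 0%N s j).
  by have [hj _] := layer_nth j; apply: hfold_sub hj.
pose t (j : 'I_n) := sgr_monom (nth 0%N s j).
have tE (i j : 'I_n) : t i (nth 0%N s j) = (i == j)%:R.
  by rewrite /t sgr_monomE // nth_uniq // eq_sym.
have Ft j : fold_ideal h (t j).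
  move=> k; rewrite /t sgr_monomE //; case: (k =P _) => [-> _|]; rewrite ?eqxx //.
  by have [] := layer_nth j.
have sumE d (c : 'I_d -> K) (v : 'I_d -> R) k : (\sum_i c i *: v i) k = \sum_i c i * v i k.
  by rewrite sgr_coef_sum; apply: eq_bigr.
apply: xget_unique => [|d [v [Fv v_free v_span]]].
  have sum_t (c : 'I_n -> K) (j : 'I_n) : (\sum_i c i *: t i) (nth 0%N s j) = c j.
    rewrite sumE (bigD1 j) //= tE eqxx mulr1 big1 ?addr0 // => i ne_ij.
    by rewrite tE (negPf ne_ij) mulr0.
  exists t; split=> // [c|u Fu].
    move=> /(fold_ideal_layer h s _ sP (Fsum _ c t Ft)) c0 i.
    by rewrite -(sum_t c i) c0.
  exists (fun i => u (nth 0%N s i)).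
  apply/(fold_ideal_layer h s _ sP); first by apply: FB => //; apply: Fsum.
  by move=> j; rewrite sgr_coefB sum_t subrr.
pose A := \matrix_(i < d, j < n) v i (nth 0%N s j).
have A_free : row_free A.
  apply: inj_row_free => c cA0; apply/rowP => i; rewrite mxE.
  apply: (v_free (fun i => c 0 i)); apply/(fold_ideal_layer h s _ sP); first exact: Fsum.
  move=> j; rewrite sumE; move/rowP/(_ j): cA0; rewrite !mxE => {2}<-.
  by apply: eq_bigr => k _; rewrite mxE.
have [B BP] := choice (fun j => v_span (t j) (Ft j)).
have A_full : row_full A.
  apply/row_fullP; exists (\matrix_(j, i) B j i); apply/matrixP => j k.
  have /(fold_ideal_layer h s _ sP (FB _ _ (Ft j) (Fsum _ (B j) v Fv)))/(_ k) := BP j.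
  rewrite sgr_coefB tE sumE => /eqP; rewrite subr_eq0 => /eqP tjk.
  by rewrite [RHS]mxE tjk mxE; apply: eq_bigr => i _; rewrite !mxE.
by rewrite -(eqP A_free) (eqP A_full).
Qed.

Lemma hilbert_layer h s : uniq s -> (forall n, layer S h n <-> n \in s) ->
  hilbert m h = size s.
Proof. by move=> us sP; rewrite /hilbert !ideal_expE; apply: quotient_dim_fold. Qed.

End Ring.

Theorem corollary2p8 (K : fieldType) (S : numSemigroup) (g : seq nat) :
  infinite_set [set: K] ->
  min_generators S g ->
  (let g1 := head 0%N g in
   [set omega S g1 i | i in
     [set i : nat | (i < g1)%N /\ (apery_b S g1 i)%:Z < apery_a S g1 i]]
     #<= `I_3) ->
  forall h : nat,
    (hilbert (max_ideal K S g) h <= hilbert (max_ideal K S g) h.+1)%N.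
Proof.
move=> _ g_min /= few h.
have S_submonoid := numSemigroupP S.
have g1_pos := head_generator S g S_submonoid g_min.
have g1_min := head_generator_min S g S_submonoid g_min.
have [s [us sP]] := layer_enum _ S_submonoid _ g1_pos h.
have [s1 [us1 s1P]] := layer_enum _ S_submonoid _ g1_pos h.+1.
rewrite (hilbert_layer K S g g_min h s us sP) (hilbert_layer K S g g_min h.+1 s1 us1 s1P).
apply: (layer_size_le _ S_submonoid _ g1_pos g1_min h) => // D.
exact: (ker_layer_size _ S_submonoid _ g1_pos g1_min).
Qed.
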